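(* Let $\mathcal{E}$ be a nilpotent evolution algebra over a field $\mathbb{K}$ of characteristic different from $2$. If $\mathcal{E}$ is modular, then there does not exist an absolute nilpotent element of $\mathcal{E}$ outside the annihilator of $\mathcal{E}$; that is, every $u\in\mathcal{E}$ with $u^2=0$ lies in $\mathrm{ann}(\mathcal{E})$.
   Context: An evolution algebra over a field $\mathbb{K}$ is a finite-dimensional $\mathbb{K}$-algebra $\mathcal{E}$ (bilinear product, not necessarily associative) admitting a basis $B=\{e_1,\dots,e_n\}$, called a natural basis, with $e_ie_j=0$ for $i\neq j$. Put $\mathcal{E}^1=\mathcal{E}$ and $\mathcal{E}^{k+1}=\sum_{i=1}^k\mathcal{E}^i\mathcal{E}^{k+1-i}$; $\mathcal{E}$ is nilpotent if $\mathcal{E}^k=0$ for some $k$. The annihilator is $\mathrm{ann}(\mathcal{E})=\{x\in\mathcal{E}: x\mathcal{E}=0\}$, which equals the span of those $e_i\in B$ with $e_i^2=0$. An element $u$ is absolute nilpotent if $u^2=0$. $\langle S\rangle$ denotes the subalgebra generated by $S$. $\mathcal{E}$ is modular if $\langle U,V\cap W\rangle=\langle U,V\rangle\cap W$ for all subalgebras $U,V,W$ of $\mathcal{E}$ with $U\subseteq W$. *)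

(* Defs.v *)
From HB Require Import structures.
From mathcomp Require Import all_boot all_order all_algebra.

Set Implicit Arguments.
Unset Strict Implicit.
Unset Printing Implicit Defensive.

Import GRing.Theory.
Local Open Scope ring_scope.

(* A finite-dimensional, not necessarily associative or unital, K-algebra is a
   [vectType K] together with a bilinear product [mul]. *)

Section EvolutionAlgebras.

Variables (K : fieldType) (E : vectType K) (mul : {bilinear E -> E -> E}).

Implicit Types (U V W : {vspace E}) (S : E -> Prop).

Definition natural_basis n (e : n.-tuple E) : Prop :=
  basis_of fullv e /\ (forall i j : 'I_n, i != j -> mul e`_i e`_j = 0).

Definition evolution_algebra : Prop :=
  exists n (e : n.-tuple E), natural_basis e.

Definition prodsp U V : {vspace E} :=
  <<[seq mul u v | u <- vbasis U, v <- vbasis V]>>%VS.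

Lemma prodsp_subP U V W :
  reflect (forall u v, u \in U -> v \in V -> mul u v \in W)
          (prodsp U V <= W)%VS.
Proof.
apply: (iffP span_subvP) => [sW u v|sW x /allpairsP[[u v] /= [uU vV ->]]];
  last by apply: sW; exact: vbasis_mem.
move=> /coord_vbasis-> /coord_vbasis->.
rewrite linear_sumlz; apply: memv_suml => i _.
rewrite linear_sumr /=; apply: memv_suml => j _.
rewrite linearZl_LR linearZr_LR /= !memvZ// sW//.
by apply/allpairsP; exists ((vbasis U)`_i, (vbasis V)`_j);
  rewrite !mem_nth ?size_tuple.
Qed.

(* [powers n] is the list E^1, ..., E^(n+1); its entry of index i is E^(i+1). *)
Fixpoint powers n : seq {vspace E} :=
  if n is n'.+1 then
    let s := powers n' in
    rcons s (\sum_(i < n) prodsp (nth 0 s i) (nth 0 s (n' - i)))%VS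
  else [:: fullv].

(* E^k; meaningful for k > 0 only, see [power1] and [powerS]. *)
Definition power k : {vspace E} := nth 0%VS (powers k.-1) k.-1.

Lemma power1 : power 1 = fullv.
Proof. by []. Qed.

Lemma size_powers n : size (powers n) = n.+1.
Proof. by elim: n => //= n IHn; rewrite size_rcons IHn. Qed.

Lemma nth_powers n i : (i <= n)%N -> nth 0%VS (powers n) i = power i.+1.
Proof.
elim: n => [|n IHn]; first by rewrite leqn0 => /eqP->.
rewrite leq_eqVlt ltnS => /predU1P[-> //|le_in].
by rewrite /= nth_rcons size_powers ltnS le_in IHn.
Qed.

Lemma powerS k : (0 < k)%N ->
  power k.+1 = (\sum_(1 <= i < k.+1) prodsp (power i) (power (k.+1 - i)))%VS.
Proof.
case: k => // k _; rewrite /power /= nth_rcons size_powers ltnn eqxx.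
rewrite big_add1 big_mkord; apply: eq_bigr => i _.
have le_ik : (i <= k)%N by rewrite -ltnS.
by rewrite !nth_powers ?leq_subr// subSS subSn.
Qed.

Definition nilpotent_algebra : Prop :=
  exists2 k, (0 < k)%N & power k = 0%VS.

Definition annihilator (x : E) : Prop := forall y, mul x y = 0.

Definition absolute_nilpotent (u : E) : Prop := mul u u = 0.

Definition subalgebra U : Prop :=
  forall x y, x \in U -> y \in U -> mul x y \in U.

(* The subalgebra generated by S, as the intersection of the subalgebras
   containing S. *)
Definition generated S (x : E) : Prop :=
  forall U, subalgebra U -> (forall y, S y -> y \in U) -> x \in U.

Definition modular_algebra : Prop :=
  forall U V W, subalgebra U -> subalgebra V -> subalgebra W -> (U <= W)%VS ->
  forall x,
    generated (fun y => y \in U \/ y \in (V :&: W)%VS) x <->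
    generated (fun y => y \in U \/ y \in V) x /\ x \in W.

End EvolutionAlgebras.

(* Main.v *)
Require Import Defs.
From mathcomp Require Import all_boot all_order all_algebra.

(** Let [u] and [v] have square zero, with [v] not in [Ku].  If [j] is the last
    index with [v \in Ku + I_j], where [I_(j+1) = I_j E], then the subalgebra
    [W = Ku + I_(j+1)] contains [uv] and meets [Kv] trivially, so modularity
    puts [uv] in [Ku], and nilpotency gives [uv = 0].  In a natural basis,
    flipping the sign of one coordinate [a_i] of an absolute nilpotent [u] gives
    another absolute nilpotent [u' = u - 2 a_i e_i]; hence
    [0 = u u' = - 2 a_i^2 e_i^2], so that [a_i e_i^2 = 0] for every [i]. *)

Set Implicit Arguments.
Unset Strict Implicit.
Unset Printing Implicit Defensive.

Import GRing.Theory.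
Local Open Scope ring_scope.

Section Algebra.

Variables (K : fieldType) (E : vectType K) (mul : {bilinear E -> E -> E}).

(** The chain [I_j] above, numbered from [I_0 = E]; hence the shift by one against [power]. *)
Fixpoint right_power k : {vspace E} :=
  if k is k'.+1 then prodsp mul (right_power k') fullv else fullv.

Lemma mem_right_powerS k x y :
  x \in right_power k -> mul x y \in right_power k.+1.
Proof.
by move=> xk; apply: (prodsp_subP _ _ _ _ (subvv _)) => //; exact: memvf.
Qed.

Lemma right_powerS_sub k : (right_power k.+1 <= right_power k)%VS.
Proof.
elim: k => [|k IHk]; first exact: subvf.
by apply/prodsp_subP => x y /(subvP IHk) xk _; exact: mem_right_powerS.
Qed.

(** By induction, [I_k E] lies in the last summand [E^(k+1) E^1] of the sum defining [E^(k+2)]. *)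
Lemma right_power_sub k : (right_power k <= power mul k.+1)%VS.
Proof.
elim: k => [|k IHk]; first by rewrite power1.
rewrite powerS // big_nat_recr //= subSnn power1.
apply: subv_trans (addvSr _ _).
apply/prodsp_subP => x y /(subvP IHk) xk _.
by apply: (prodsp_subP _ _ _ _ (subvv _)) => //; exact: memvf.
Qed.

Lemma nilpotent_right_power :
  nilpotent_algebra mul -> exists k, right_power k = 0%VS.
Proof.
case=> -[//|k] _ k0; exists k.
by apply/eqP; rewrite -subv0 -k0 right_power_sub.
Qed.

(** If [a] were nonzero, [u] would be a multiple of [uv], so it would pass from each [I_k] to the
    next and end up in 0. *)
Lemma nilpotent_mul_eigen (u v : E) (a : K) :
  nilpotent_algebra mul -> mul u v = a *: u -> mul u v = 0.
Proof.
move=> /nilpotent_right_power[k k0] uv; rewrite uv.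
have [-> | a0] := eqVneq a 0; first by rewrite scale0r.
suff: u \in right_power k by rewrite k0 memv0 => /eqP->; rewrite scaler0.
elim: {k0}k => [|k IHk]; first exact: memvf.
by have:= mem_right_powerS v IHk; rewrite uv rpredZeq (negPf a0).
Qed.

Lemma modular_absolute_nilpotent_mul (u v : E) :
  (forall x y, mul x y = mul y x) ->
  nilpotent_algebra mul -> modular_algebra mul ->
  absolute_nilpotent mul u -> absolute_nilpotent mul v -> mul u v = 0.
Proof.
move=> mulC nilE modE uu vv.
have [/vlineP[a ->]|vNu] := boolP (v \in <[u]>%VS).
  by rewrite linearZr_LR /= uu scaler0.
(* Since [v] lies in [Ku + I_0 = E] but not in [Ku + I_k = Ku] once [I_k = 0], descending from [k]
   meets such a [j]. *)
have [j vj vNj] : exists2 j, v \in (<[u]> + right_power j)%VS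
    & v \notin (<[u]> + right_power j.+1)%VS.
  have [k k0] := nilpotent_right_power nilE.
  have: v \notin (<[u]> + right_power k)%VS by rewrite k0 addv0.
  elim: {k0}k => [|k IHk vNk]; first by rewrite addvf memvf.
  by have [vk|/IHk//] := boolP (v \in (<[u]> + right_power k)%VS); exists k.
have line_subalgebra x : mul x x = 0 -> subalgebra mul <[x]>%VS.
  move=> xx _ _ /vlineP[a ->] /vlineP[b ->].
  by rewrite linearZl_LR linearZr_LR /= xx !scaler0 mem0v.
set W := (<[u]> + right_power j.+1)%VS in vNj.
have uW : u \in W by apply: (subvP (addvSl _ _)); exact: memv_line.
(* Writing [v = au + z] with [z] in [I_j] gives [uv = uz = zu]. *)
have uvW : mul u v \in W.
  apply: (subvP (addvSr _ _)).
  case/memv_addP: vj => _ /vlineP[a ->] [z zj ->].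
  by rewrite linearDr linearZr_LR /= uu scaler0 add0r mulC mem_right_powerS.
(* In a product of two elements of [W] the term in [u^2] vanishes, and every other term has a factor
   in [I_(j+1)]. *)
have subW : subalgebra mul W.
  move=> _ _ /memv_addP[_ /vlineP[a ->] [x xj ->]]
    /memv_addP[_ /vlineP[b ->] [y yj ->]].
  apply: (subvP (addvSr _ _)); rewrite linearDl.
  apply: memvD; last exact/(subvP (right_powerS_sub j.+1))/mem_right_powerS.
  rewrite linearDr /= !linearZl_LR linearZr_LR /= uu !scaler0 add0r memvZ //.
  by rewrite mulC; exact/(subvP (right_powerS_sub j.+1))/mem_right_powerS.
have uWs : (<[u]> <= W)%VS by rewrite -memvE.
have [_ modW] := modE _ _ _ (line_subalgebra _ uu) (line_subalgebra _ vv) subW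
  uWs (mul u v).
have {}modW : generated mul
    (fun y => y \in <[u]>%VS \/ y \in (<[v]> :&: W)%VS) (mul u v).
  apply: modW; split=> // X subX X_uv.
  by apply: subX; apply: X_uv; [left|right]; exact: memv_line.
(* The line [Ku] is a subalgebra containing all the generators: [bv] in [W] with [b] nonzero would
   put [v] in [W]. *)
have: mul u v \in <[u]>%VS.
  apply: (modW _ (line_subalgebra _ uu)).
  move=> y [//|]; rewrite memv_cap => /andP[/vlineP[b ->]].
  have [->|b0] := eqVneq b 0; first by rewrite scale0r !mem0v.
  by rewrite !rpredZeq (negPf b0) (negPf vNj).
by case/vlineP=> a; exact: nilpotent_mul_eigen.
Qed.

Lemma natural_basis_mull n (e : n.-tuple E) x (i : 'I_n) :
  natural_basis mul e -> mul x e`_i = coord e i x *: mul e`_i e`_i.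
Proof.
case=> be e_orth; rewrite {1}(coord_basis be (memvf x)) linear_sumlz.
rewrite (bigD1 i) //= big1 ?addr0 ?linearZl_LR // => j ji.
by rewrite linearZl_LR /= e_orth ?scaler0.
Qed.

Lemma natural_basis_mulr n (e : n.-tuple E) x (i : 'I_n) :
  natural_basis mul e -> mul e`_i x = coord e i x *: mul e`_i e`_i.
Proof.
case=> be e_orth; rewrite {1}(coord_basis be (memvf x)) linear_sumr.
rewrite (bigD1 i) //= big1 ?addr0 ?linearZr_LR // => j ji.
by rewrite linearZr_LR /= e_orth ?scaler0 // eq_sym.
Qed.

(** Both products expand to the sum of the [x_i y_i e_i^2]. *)
Lemma evolution_algebraC x y : evolution_algebra mul -> mul x y = mul y x.
Proof.
case=> n [e nbe]; rewrite (coord_basis nbe.1 (memvf y)).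
rewrite linear_sumr linear_sumlz; apply: eq_bigr => i _.
rewrite linearZr_LR linearZl_LR /=.
by rewrite (natural_basis_mull x i nbe) (natural_basis_mulr x i nbe).
Qed.

End Algebra.

Theorem proposition5p4 (K : fieldType) (E : vectType K)
    (mul : {bilinear E -> E -> E})
    (charK : 2%N \notin [pchar K])
    (evolE : evolution_algebra mul)
    (nilE : nilpotent_algebra mul)
    (modE : modular_algebra mul) :
  forall u : E, absolute_nilpotent mul u -> annihilator mul u.
Proof.
move=> u uu y; have mulC x z := evolution_algebraC x z evolE.
have [n [e nbe]] := evolE.
rewrite (coord_basis nbe.1 (memvf y)) linear_sumr big1 // => i _.
rewrite linearZr_LR /=; set a := coord e i u.
have ue : mul u e`_i = a *: mul e`_i e`_i by exact: natural_basis_mull.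
pose u' := u - (2%:R * a) *: e`_i.
have uu' : mul u u' = - (2%:R * a) *: mul u e`_i.
  by rewrite linearBr linearZr_LR /= uu sub0r scaleNr.
(* Here [u'^2 = -2a (u e_i + e_i u) + 4a^2 e_i^2], and [u e_i = e_i u = a e_i^2]. *)
have u'u' : absolute_nilpotent mul u'.
  rewrite /absolute_nilpotent {1}/u' linearBl linearZl_LR /= uu'.
  rewrite linearBr linearZr_LR /= (mulC _ u) ue -scalerBl mulr_natl.
  have -> : a - a *+ 2 = - a by rewrite mulr2n opprD addNKr.
  by rewrite !scaleNr scalerN opprK addNr.
have := modular_absolute_nilpotent_mul mulC nilE modE uu u'u'.
move/eqP; rewrite uu' scaler_eq0 oppr_eq0 mulf_eq0.
(* The characteristic enters here: cancelling 2 leaves [a = 0] or [u e_i = 0], and the former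
   implies the latter. *)
have -> : (2%:R == 0 :> K) = false by apply: contraNF charK; rewrite inE.
by case/orP=> /eqP => [a0|->]; rewrite ?scaler0 // ue a0 scale0r scaler0.
Qed.
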